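(* Let $\alpha_n:=2/(n+2)$ for $n\in\mathbb{N}$. Suppose that $(X_n),(C_n)$ are nonnegative stochastic processes satisfying $$X_{n+1}\le(1-\alpha_{n+1})X_n+C_n$$ almost surely for all $n\in\mathbb{N}$, and that $\mathbb{E}[C_n]\le(\alpha_n-\alpha_{n+1})L$ for all $n\in\mathbb{N}$, where $L$ is a real number with $L\ge\mathbb{E}[X_0]$. Then $$\mathbb{E}[X_n]\le\frac{2L}{n+2}\qquad\text{and}\qquad\mathbb{P}\left(\exists i\ge n\,(X_i\ge\varepsilon)\right)\le\frac1\varepsilon\,\frac{4L}{n+2}$$ for all $n\in\mathbb{N}$ and all $\varepsilon>0$.
   Context: All random variables live on a fixed probability space $(\Omega,\mathcal{F},\mathbb{P})$; a stochastic process is a sequence of real-valued random variables indexed by $\mathbb{N}=\{0,1,2,\dots\}$. *)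

(* Defs.v *)
From HB Require Import structures.
From mathcomp Require Export all_boot all_order all_algebra.
From mathcomp Require Export all_classical all_reals all_analysis.

Set Implicit Arguments.
Unset Strict Implicit.
Unset Printing Implicit Defensive.

Import Order.TTheory GRing.Theory Num.Theory.
Local Open Scope ring_scope.

Definition alpha (R : realType) (n : nat) : R := 2 / (n.+2)%:R.
Arguments alpha : clear implicits.

(* Nonnegativity of a random process is understood almost surely. *)
Definition nonneg_process (d : measure_display) (T : measurableType d)
    (R : realType) (P : probability T R) (X : nat -> {RV P >-> R}) : Prop :=
  forall n : nat, \forall w \ae P, 0 <= X n w.

(* Main.v *)
Require Import Defs.
From HB Require Import structures.
From mathcomp Require Import all_boot all_order all_algebra.
From mathcomp Require Import all_classical all_reals all_analysis.
From mathcomp Require Import measurable_realfun ring.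

Import Order.TTheory GRing.Theory Num.Theory.
Local Open Scope classical_set_scope.
Local Open Scope ring_scope.

(** Both bounds come from first moments and the telescoping of alpha.

    Bound in mean: taking expectations in the recursion, the claim
    E X_n <= alpha_n * L propagates by induction because the sequence alpha
    satisfies the exact identity
      (1 - alpha_{n+1}) alpha_n + (alpha_n - alpha_{n+1}) = alpha_{n+1}
    ([alpha_step]).

    Maximal bound: since X is nonnegative and the factor 1 - alpha_{n+1} is at
    most 1, the recursion gives X_{i+1} <= X_i + C_i almost surely.  Hence
    after time n the whole path stays below the single random variable
      Y = X_n + C_n + C_{n+1} + C_{n+2} + ...
    and Markov's inequality for Y controls the event that X ever reaches eps
    ([maximal_inequality]).  Its mean is at most alpha_n L plus the telescoping
    sum of the (alpha_k - alpha_{k+1}) L over k >= n, which is at most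
    alpha_n L; this is where the extra factor 2 comes from.

    Nonnegativity holds only almost surely, so integrals are computed on
    absolute values, which are nonnegative everywhere and change no
    expectation ([nneg_expectation]). *)

Lemma alpha_step (R : realType) (n : nat) :
  (1 - alpha R n.+1) * alpha R n + (alpha R n - alpha R n.+1) = alpha R n.+1.
Proof.
have n3E : n.+3%:R = n.+2%:R + 1 :> R by rewrite natr1.
rewrite /alpha n3E.
have : (0 : R) < n.+2%:R by rewrite ltr0n.
by move: (n.+2%:R : R) => x x0; field; rewrite !gt_eqF// addr_gt0.
Qed.

Lemma alpha_ge0 (R : realType) (n : nat) : 0 <= alpha R n.
Proof. by rewrite /alpha divr_ge0. Qed.

Lemma alpha_le1 (R : realType) (n : nat) : alpha R n <= 1.
Proof. by rewrite /alpha ler_pdivrMr ?ltr0n// mul1r ler_nat. Qed.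

Section process_bounds.
Context (d : measure_display) (T : measurableType d) (R : realType).
Variable P : probability T R.

Let measurable_abs (X : {RV P >-> R}) :
  measurable_fun [set: T] (fun w => `|X w|%:E).
Proof. by apply/measurable_EFinP; exact: measurableT_comp. Qed.

Lemma nneg_expectation (X : {RV P >-> R}) :
  (\forall w \ae P, 0 <= X w) -> ('E_P[X] = \int[P]_w `|X w|%:E)%E.
Proof.
move=> X0; rewrite expectation_def; apply: ae_eq_integral => //.
  exact/measurable_EFinP.
by apply: filterS X0 => w X0 _; rewrite ger0_norm.
Qed.

Lemma nneg_expectation_ge0 (X : {RV P >-> R}) :
  (\forall w \ae P, 0 <= X w) -> (0 <= 'E_P[X])%E.
Proof.
by move=> X0; rewrite nneg_expectation//; apply: integral_ge0 => w _.
Qed.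

(** The expectations may be infinite here, so the additivity used is that of
    integrals of nonnegative functions. *)
Lemma expectation_recursion (X Y C : {RV P >-> R}) (a : R) : 0 <= a ->
    (\forall w \ae P, 0 <= X w) -> (\forall w \ae P, 0 <= Y w) ->
    (\forall w \ae P, 0 <= C w) ->
    (\forall w \ae P, Y w <= a * X w + C w) ->
  ('E_P[Y] <= a%:E * 'E_P[X] + 'E_P[C])%E.
Proof.
move=> a0 X0 Y0 C0 YXC; rewrite !nneg_expectation//.
rewrite -ge0_integralZl//.
have maX : measurable_fun [set: T] (fun w => (a%:E * `|X w|%:E)%E).
  by apply: measurable_funeM; exact: measurable_abs.
rewrite -ge0_integralD//; first last.
- by move=> w _; rewrite mule_ge0.
apply: ae_ge0_le_integral => //.
- by move=> w _; rewrite adde_ge0// mule_ge0.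
- by apply: emeasurable_funD => //; exact: measurable_abs.
apply: filterS2 Y0 YXC => w Y0 YXC _.
rewrite -EFinM -EFinD lee_fin ger0_norm// (le_trans YXC)//.
by rewrite lerD ?ler_norm// ler_wpM2l ?ler_norm.
Qed.

(** Almost surely eps 1_A <= Y, and integrating this gives Markov's inequality.
    Asking for domination of A only almost surely absorbs the null set on which
    the recursion fails, and extended-real values let Y be an infinite
    series. *)
Lemma markov_ae (A : set T) (Y : T -> \bar R) (eps : R) :
    measurable A -> measurable_fun [set: T] Y -> (forall w, 0 <= Y w)%E ->
    0 < eps -> (\forall w \ae P, A w -> (eps%:E <= Y w)%E) ->
  (eps%:E * P A <= \int[P]_w Y w)%E.
Proof.
move=> mA mY Y0 eps0 AY.
have <- : (\int[P]_w (eps%:E * (\1_A w)%:E) = eps%:E * P A)%E.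
  rewrite ge0_integralZl//; first by rewrite integral_indic// setIT.
    exact/measurable_EFinP.
  by rewrite lee_fin ltW.
apply: ae_ge0_le_integral => //.
- by move=> w _; rewrite mule_ge0// lee_fin ?ltW.
- by apply: measurable_funeM; exact/measurable_EFinP.
apply: filterS AY => w AY _; rewrite indicE.
have [/set_mem/AY|_] := boolP (w \in A); first by rewrite mule1.
by rewrite mule0.
Qed.

Lemma measurable_hitting (X : nat -> {RV P >-> R}) (n : nat) (eps : R) :
  measurable [set w | exists i : nat, (n <= i)%N /\ eps <= X i w].
Proof.
rewrite [X in measurable X](_ : _ =
    \bigcup_(i in [set i | (n <= i)%N]) [set w | eps <= X i w]).
  apply: bigcup_measurable => i _.
  rewrite -[X in measurable X]setTI.
  exact: (@measurable_fun_le _ _ _ setT (cst eps) (X i)).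
by apply/seteqP; split => [w [i [ni ei]]|w [i ni ei]]; exists i.
Qed.

(** Iterating X_{k+1} <= X_k + C_k from time n bounds every later X_i by one
    variable, X_n plus the whole series of the C_k with k >= n, so a single
    application of Markov's inequality handles all times i >= n at once. *)
Lemma maximal_inequality (X C : nat -> {RV P >-> R}) (n : nat) (eps : R) :
    nonneg_process X -> nonneg_process C ->
    (forall k, \forall w \ae P, X k.+1 w <= X k w + C k w) -> 0 < eps ->
  (eps%:E * P [set w | exists i : nat, (n <= i)%N /\ (eps <= X i w)%R]
    <= 'E_P[X n] + \sum_(k <oo) 'E_P[C (n + k)%N])%E.
Proof.
move=> X0 C0 XC eps0.
rewrite nneg_expectation//.
under eq_eseriesr do rewrite nneg_expectation//.
rewrite -integral_nneseries//.
have mC : measurable_fun [set: T]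
    (fun w => \sum_(k <oo) `|C (n + k)%N w|%:E)%E.
  by apply: ge0_emeasurable_sum => // k _; exact: measurable_abs.
have sC0 w : (0 <= \sum_(k <oo) `|C (n + k)%N w|%:E)%E.
  exact: nneseries_ge0.
rewrite -ge0_integralD//.
apply: markov_ae => //.
- exact: measurable_hitting.
- by apply: emeasurable_funD => //; exact: measurable_abs.
- by move=> w; rewrite adde_ge0.
apply: filterS (ae_foralln XC) => w {}XC [i [ni eX]].
have XnC m : X (n + m)%N w <= `|X n w| + \sum_(0 <= k < m) `|C (n + k)%N w|.
  elim: m => [|m IH]; first by rewrite addn0 big_geq// addr0 ler_norm.
  rewrite addnS big_nat_recr//= addrA (le_trans (XC _))//.
  by rewrite lerD// ler_norm.
move: (XnC (i - n)%N); rewrite subnKC// => XiC.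
apply: (@le_trans _ _
    (`|X n w| + \sum_(0 <= k < i - n) `|C (n + k)%N w|)%:E).
  by rewrite lee_fin (le_trans eX).
by rewrite EFinD leeD2l// -sumEFin; exact: nneseries_lim_ge.
Qed.

End process_bounds.

(** The partial sums telescope to at most (alpha_n - alpha_{n+m}) L, and
    alpha >= 0. *)
Lemma alpha_tail_sum (R : realType) (L : R) (c : nat -> \bar R) (n : nat) :
    0 <= L -> (forall k, 0 <= c k)%E ->
    (forall k, c k <= ((alpha R k - alpha R k.+1) * L)%:E)%E ->
  (\sum_(k <oo) c (n + k)%N <= (alpha R n * L)%:E)%E.
Proof.
move=> L0 c0 cL; apply: lime_le; first exact: is_cvg_nneseries.
apply: nearW => m.
apply: (@le_trans _ _ ((alpha R n - alpha R (n + m)) * L)%:E); last first.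
  by rewrite lee_fin ler_wpM2r// gerBl alpha_ge0.
elim: m => [|m IH]; first by rewrite big_geq// addn0 subrr mul0r.
rewrite big_nat_recr//= (le_trans (leeD IH (cL _)))//.
by rewrite -EFinD lee_fin -mulrDl addrA subrK addnS.
Qed.

Theorem lemma4p2 (d : measure_display) (T : measurableType d) (R : realType)
    (P : probability T R) (X C : nat -> {RV P >-> R}) (L : R)
    (X_ge0 : nonneg_process X) (C_ge0 : nonneg_process C)
    (X_rec : forall n : nat, \forall w \ae P,
        X n.+1 w <= (1 - alpha R n.+1) * X n w + C n w)
    (C_exp : forall n : nat,
        ('E_P[C n] <= ((alpha R n - alpha R n.+1) * L)%:E)%E)
    (L_ge : ('E_P[X 0%N] <= L%:E)%E) :
  forall n : nat,
    ('E_P[X n] <= (2 * L / (n%:R + 2))%:E)%E /\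
    (forall eps : R, 0 < eps ->
      (P [set w | exists i : nat, (n <= i)%N /\ (eps <= X i w)%R]
        <= (eps^-1 * (4 * L / (n%:R + 2)))%:E)%E).
Proof.
have L0 : 0 <= L.
  by rewrite -lee_fin (le_trans _ L_ge)// nneg_expectation_ge0.
have EX n : ('E_P[X n] <= (alpha R n * L)%:E)%E.
  elim: n => [|n IH]; first by rewrite /alpha divff ?pnatr_eq0// mul1r.
  have a0 : 0 <= 1 - alpha R n.+1 by rewrite subr_ge0 alpha_le1.
  apply: (le_trans (@expectation_recursion _ _ _ _ _ _ _ _ a0
    (X_ge0 n) (X_ge0 n.+1) (C_ge0 n) (X_rec n))).
  rewrite -[in leRHS]alpha_step mulrDl [in leRHS]EFinD leeD// -mulrA EFinM.
  by rewrite lee_wpmul2l.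
have XC k : \forall w \ae P, X k.+1 w <= X k w + C k w.
  apply: filterS2 (X_ge0 k) (X_rec k) => w Xk0 /le_trans; apply.
  by rewrite lerD2r ler_piMl// gerBl alpha_ge0.
move=> n.
have alphaE : alpha R n = 2 / (n%:R + 2) by rewrite /alpha -natrD addn2.
split=> [|eps eps0]; first by rewrite mulrAC -alphaE.
rewrite EFinM lee_pdivlMl//.
apply: (le_trans (@maximal_inequality _ _ _ P X C n eps X_ge0 C_ge0 XC eps0)).
have -> : 4 * L / (n%:R + 2) = alpha R n * L + alpha R n * L.
  by rewrite alphaE; ring.
rewrite EFinD leeD//; apply: (@alpha_tail_sum _ _ (fun k => 'E_P[C k]%E)) => // k.
exact: nneg_expectation_ge0.
Qed.
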